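(* Let $k$ and $i$ be fixed positive integers with $1\leq i\leq k+1$. Then for every positive integer $n$, \[ \overline{\eta}_{2k}(n)=\sum_{m=1}^{\infty}\binom{m+k-1}{2k}N(m,n) \] is equal to the number of $(k+1)$-marked Durfee symbols $\tau$ of $n$ whose $i$-th rank $\rho_i(\tau)$ is negative.
   Context: A partition $\lambda=(\lambda_1,\ldots,\lambda_s)$ has parts $\lambda_1\ge\cdots\ge\lambda_s\ge1$; $\ell(\lambda)=s$ is its number of parts and $|\lambda|$ its sum. The rank of a partition is its largest part minus its number of parts, and $N(m,n)$ denotes the number of partitions of $n$ with rank $m$. For a positive integer $k$, a $k$-marked Durfee symbol of $n$ is an array $\tau=\begin{pmatrix}\alpha^k,&\alpha^{k-1},&\ldots,&\alpha^1\\ \beta^k,&\beta^{k-1},&\ldots,&\beta^1\end{pmatrix}_D$ consisting of $k$ pairs $(\alpha^j,\beta^j)$ of partitions and a positive integer $D$ such that: (1) $\alpha^j$ is nonempty for $1\le j<k$, while $\alpha^k$ and all $\beta^j$ may be empty; (2) for $2\le j\le k$, $\beta^{j-1}_1\le\alpha^{j-1}_1\le\min\{\alpha^j_s,\beta^j_s\}$, where $\alpha^j_s,\beta^j_s$ denote the smallest parts of $\alpha^j,\beta^j$ (the minimum taken over those that are nonempty), and $\beta^{j-1}_1$ is the largest part of $\beta^{j-1}$ (condition vacuous if empty); (3) the largest parts $\alpha^k_1,\beta^k_1$ are at most $D$; (4) $\sum_{j=1}^k(|\alpha^j|+|\beta^j|)+D^2=n$. The $j$-th rank of $\tau$ is $\rho_j(\tau)=\ell(\alpha^j)-\ell(\beta^j)-1$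 for $1\le j<k$ and $\rho_k(\tau)=\ell(\alpha^k)-\ell(\beta^k)$.
   Formalization: In condition (2), when α^k and β^k are both empty the minimum is undefined; it is taken to be D, so α^{k-1}_1 ≤ D is required. With no bound the claim fails for k=i=1, n=4 (3 versus 4). *)

(* Defs.v *)
From mathcomp Require Import all_boot all_order all_algebra.
From mathcomp Require Import zify.

Set Implicit Arguments.
Unset Strict Implicit.
Unset Printing Implicit Defensive.

Import Order.TTheory GRing.Theory Num.Theory.

Definition is_partition (p : seq nat) : bool :=
  sorted geq p && all (leq 1) p.

Definition is_partition_of (n : nat) (p : seq nat) : bool :=
  is_partition p && (sumn p == n).

Definition largest (p : seq nat) : nat := head 0 p.

Definition rank (p : seq nat) : int := ((largest p)%:Z - (size p)%:Z)%R.

(* The sequences of at most n numbers, each at most n, form a finite type.    *)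
(* They include all partitions of the integers m <= n: see [bounded_onto].    *)
Definition bounded (n : nat) : Type := n.-bseq 'I_n.+1.

Definition parts (n : nat) (p : bounded n) : seq nat := [seq val x | x <- p].

Definition N (m : int) (n : nat) : nat :=
  #|[set p : bounded n | is_partition_of n (parts p) & rank (parts p) == m]|.

(* N m n = 0 for positive m >= n, so this is the sum over all m >= 1: see     *)
(* [etabar_partial_sums].                                                     *)
Definition etabar (k n : nat) : nat :=
  \sum_(1 <= m < n.+1) 'C(m + k - 1, 2 * k) * N m%:Z n.

(* [:: (alpha^1, beta^1); ...; (alpha^k, beta^k)] together with D; note that  *)
(* the array displays the pairs from k down to 1.                             *)
Definition symbol : Type := (seq (seq nat * seq nat) * nat)%type.

Definition side (tau : symbol) : nat := tau.2.

(* The superscript j runs from 1 to k. *)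
Definition alpha (tau : symbol) (j : nat) : seq nat :=
  (nth ([::], [::]) tau.1 j.-1).1.

Definition beta (tau : symbol) (j : nat) : seq nat :=
  (nth ([::], [::]) tau.1 j.-1).2.

(* An empty partition imposes the bound D: as all parts of a symbol are at    *)
(* most D, this drops the empty partition from a minimum with a nonempty one, *)
(* and when alpha^k and beta^k are both empty it leaves the bound D on        *)
(* alpha^(k-1).                                                               *)
Definition smallest (D : nat) (p : seq nat) : nat := last D p.

Definition is_marked_durfee_symbol (k n : nat) (tau : symbol) : bool :=
  [&& size tau.1 == k, 0 < side tau,
      [forall j : 'I_k.+1, (1 <= j) ==>
         is_partition (alpha tau j) && is_partition (beta tau j)],
      [forall j : 'I_k.+1, (1 <= j < k) ==> (alpha tau j != [::])],
      [forall j : 'I_k.+1, (2 <= j) ==>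
         (largest (beta tau j.-1) <= largest (alpha tau j.-1)
            <= minn (smallest (side tau) (alpha tau j))
                    (smallest (side tau) (beta tau j)))],
      (largest (alpha tau k) <= side tau) && (largest (beta tau k) <= side tau)
    & \sum_(1 <= j < k.+1) (sumn (alpha tau j) + sumn (beta tau j))
        + side tau ^ 2 == n].

Definition rho (k j : nat) (tau : symbol) : int :=
  let d := ((size (alpha tau j))%:Z - (size (beta tau j))%:Z)%R in
  if j < k then (d - 1)%R else d.

(* A finite type that contains all k-marked Durfee symbols of n: see          *)
(* [bounded_symbol_onto].                                                     *)
Definition bounded_symbol (k n : nat) : Type :=
  (k.-tuple (bounded n * bounded n) * 'I_n.+1)%type.

Definition symbol_of (k n : nat) (t : bounded_symbol k n) : symbol :=
  ([seq (parts ab.1, parts ab.2) | ab <- t.1], val t.2).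

Lemma parts_inj (n : nat) : injective (@parts n).
Proof. by move=> p q /(inj_map val_inj)/val_inj. Qed.

Lemma size_le_sumn (p : seq nat) : all (leq 1) p -> size p <= sumn p.
Proof. by elim: p => //= x p IH /andP[x1 /IH]; lia. Qed.

Lemma mem_le_sumn (p : seq nat) (x : nat) : x \in p -> x <= sumn p.
Proof.
elim: p => //= y p IH; rewrite inE => /orP[/eqP->|/IH]; lia.
Qed.

Lemma bounded_onto (n : nat) (p : seq nat) :
  is_partition p -> sumn p <= n -> exists q : bounded n, parts q = p.
Proof.
case/andP=> _ p1 pn.
have sz : size (map (@inord n) p) <= n.
  by rewrite size_map (leq_trans (size_le_sumn p1)).
exists (Bseq sz); rewrite /parts /= -map_comp -[RHS]map_id.
apply/eq_in_map => x xp /=; rewrite inordK // ltnS.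
exact: leq_trans (mem_le_sumn xp) pn.
Qed.

Lemma N_large (m n : nat) : 0 < m -> n <= m -> N m%:Z n = 0.
Proof.
move=> m0 nm; apply/eqP; rewrite cards_eq0; apply/eqP/setP=> p.
rewrite !inE; apply/negbTE/negP => /andP[/andP[_ /eqP]].
rewrite /rank /largest; case: (parts p) => [|x q] /=; lia.
Qed.

Lemma etabar_partial_sums (k n M : nat) : n < M ->
  \sum_(1 <= m < M) 'C(m + k - 1, 2 * k) * N m%:Z n = etabar k n.
Proof.
move=> nM; rewrite /etabar (@big_cat_nat _ _ _ n.+1) //=.
rewrite [X in _ + X]big_nat_cond [X in _ + X]big1 ?addn0 // => m.
by rewrite andbT => /andP[nm _]; rewrite N_large ?muln0 //; lia.
Qed.

Lemma symbol_of_inj (k n : nat) : injective (@symbol_of k n).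
Proof.
move=> [s D] [s' D'] [/inj_map eqs /val_inj ->]; congr pair.
by apply/val_inj/eqs => -[a b] [a' b'] [/parts_inj -> /parts_inj ->].
Qed.

Lemma bounded_symbol_onto (k n : nat) (tau : symbol) :
  is_marked_durfee_symbol k n tau ->
  exists t : bounded_symbol k n, symbol_of t = tau.
Proof.
case: tau => s D /and5P[/eqP szs _ /forallP parP _ /and3P[_ _ /eqP sumE]].
rewrite /= in szs.
have Dn : D < n.+1.
  by move: sumE; rewrite /side /= expnS expn1 ltnS; nia.
have onto ab : ab \in s ->
    exists c : bounded n * bounded n, (parts c.1, parts c.2) = ab.
  move=> /(nthP ([::], [::]))[j jk abE].
  rewrite szs in jk.
  have /= := parP (Ordinal (jk : j.+1 < k.+1)).
  rewrite /alpha /beta /= abE => /andP[pa pb].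
  have le : sumn ab.1 + sumn ab.2 <= n.
    rewrite -sumE (@big_cat_nat _ _ _ j.+1) //=; last by lia.
    rewrite [X in _ + X + _ ^ _]big_ltn // /alpha /beta /= abE.
    by rewrite -addnA addnCA -addnA leq_addr.
  have [|c1 E1] := bounded_onto (n := n) pa; first exact: leq_trans (leq_addr _ _) le.
  have [|c2 E2] := bounded_onto (n := n) pb; first exact: leq_trans (leq_addl _ _) le.
  by exists (c1, c2); rewrite /= E1 E2; case: (ab).
have [u uE] : exists u : seq (bounded n * bounded n),
    [seq (parts c.1, parts c.2) | c <- u] = s.
  elim: {szs parP sumE} s onto => [|ab s IH] onto; first by exists [::].
  have [c cE] := onto ab (mem_head _ _).
  have [|u uE] := IH; first by move=> x xs; apply: onto; rewrite inE xs orbT.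
  by exists (c :: u); rewrite /= cE uE.
have szu : size u == k by rewrite -szs -uE size_map.
by exists (Tuple szu, Ordinal Dn); rewrite /symbol_of /= uE.
Qed.

(* Main.v *)
(* With s_j = x_j + 1/x_j, where x_j marks the j-th rank, the generating       *)
(* function of the marked symbols with side D is a divided difference, with    *)
(* nodes s_j, of s |-> prod_(1 <= r <= D) (1 + q^(2r) - q^r s)^-1, and the     *)
(* coefficients of that product count Durfee symbols by rank. Put x_j = 1 for  *)
(* j <> i: all nodes except s = s_i become 2, and                              *)
(*   (s - 2) F(w) = F(w without one node 2) - F(w without the node s).         *)
(* The last term has only rank 0, so on negative ranks the second difference   *)
(* of the count with k + 1 pairs is the count with k pairs, for any i.         *)
(* Summing by parts k times turns the number of symbols with negative i-th     *)
(* rank into the sum over m of 'C(m + k - 1, 2k) times the number of Durfee    *)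
(* symbols of rank -m. The displayed relation needs no division: it follows    *)
(* from the recurrence obtained by removing the parts equal to D.              *)

Require Import Defs.
From mathcomp Require Import all_boot all_order all_algebra.
From mathcomp Require Import zify ring.

Set Implicit Arguments.
Unset Strict Implicit.
Unset Printing Implicit Defensive.

Import Order.TTheory GRing.Theory Num.Theory.

(** The generating function identity is proved on coefficients: [marked_count] counts chains of
    pairs by weight (without [D ^ 2]) and by the sum of the ranks marked in [w]. Removing an entry
    equal to [D] gives [marked_count_rec], whose instances combine linearly to
    [marked_count_divided]. Off rank 0 the term without marks vanishes there, so a second difference
    in the tracked rank drops one untracked pair, wherever the tracked pair sits; hence the answer
    does not depend on [i]. [marked_count_moments] sums by parts until a single pair is left.

    A single pair with its side is a partition cut along its Durfee square, and its rank is minus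
    the rank of the partition; thus [N_durfee] turns negative ranks into [N m n] with positive [m].
    The arrays are carried over to chains by [marked_durfee_symbol_wf] and [rho_tracked_rank]. *)

(** * Counting by bijections and by classes *)

Lemma count_bij (T T' : eqType) (U : seq T) (U' : seq T') (P : pred T)
    (Q : pred T') (f : T -> T') (g : T' -> T) :
  uniq U -> uniq U' ->
  (forall x, x \in U -> P x -> [/\ f x \in U', Q (f x) & g (f x) = x]) ->
  (forall y, y \in U' -> Q y -> [/\ g y \in U, P (g y) & f (g y) = y]) ->
  count P U = count Q U'.
Proof.
move=> uU uU' fP gQ; rewrite -!size_filter -(size_map f).
apply/perm_size/uniq_perm.
- rewrite map_inj_in_uniq ?filter_uniq // => x y.
  rewrite !mem_filter => /andP[Px xU] /andP[Py yU] fxy.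
  by have [_ _ <-] := fP x xU Px; have [_ _ <-] := fP y yU Py; rewrite fxy.
- exact: filter_uniq.
move=> y; rewrite mem_filter; apply/mapP/andP => [[x]|[Qy yU']].
  by rewrite mem_filter => /andP[Px xU] ->; have [] := fP x xU Px.
have [gU Pg gK] := gQ y yU' Qy.
by exists (g y); rewrite ?mem_filter ?gU ?Pg.
Qed.

Lemma count_classes (T : Type) (P : pred T) (c : T -> nat) (lo hi : nat) (s : seq T) :
  (forall x, P x -> lo <= c x < hi) ->
  count P s = \sum_(lo <= d < hi) count (fun x => P x && (c x == d)) s.
Proof.
move=> cP; elim: s => [|x s IH] /=; first by rewrite big1.
rewrite big_split /= -IH; congr addn.
case Px: (P x) => /=; last by rewrite big1.
have cx := cP x Px.
rewrite (bigD1_seq (c x)) ?mem_index_iota ?iota_uniq //= eqxx big1 // => d.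
by rewrite eq_sym => /negPf ->.
Qed.

(** * Marked symbols as chains of pairs *)

(* The pairs of a marked symbol from top to bottom, (alpha^k, beta^k) first.   *)
Definition pairs : Type := seq (seq nat * seq nat).

Definition in_range (lo hi : nat) (p : seq nat) : bool :=
  path geq hi p && all (leq lo) p.

(* When a lower pair comes to the top, the largest part M of its top row has  *)
(* been removed and has become the bound D; hence the rank of the top pair is *)
(* the plain difference of lengths, while lower pairs have the extra -1.      *)
Fixpoint top_wf (D : nat) (a b : seq nat) (t : pairs) : bool :=
  if t is (ma, b') :: t' then
    if ma is M :: a' then
      [&& 0 < M, M <= D, in_range M D a, in_range M D b & top_wf M a' b' t']
    else false
  else in_range 1 D a && in_range 1 D b.

Definition wf (D : nat) (x : pairs) : bool :=
  if x is (a, b) :: t then top_wf D a b t else false.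

Definition weight (x : pairs) : nat :=
  sumn [seq sumn ab.1 + sumn ab.2 | ab <- x].

Definition length_diff (ab : seq nat * seq nat) : int :=
  ((size ab.1)%:Z - (size ab.2)%:Z)%R.

Fixpoint lower_rank (w : seq bool) (t : pairs) : int :=
  if (w, t) is (c :: w', ab :: t')
  then (c%:Z * (length_diff ab - 1) + lower_rank w' t')%R else 0%R.

(** With a single mark, as in [tracking], the sum is the rank of that pair. Arbitrary marks keep the
    recurrence uniform when the top pair is dropped. *)
Definition tracked_rank (w : seq bool) (x : pairs) : int :=
  if (w, x) is (c :: w', ab :: t)
  then (c%:Z * length_diff ab + lower_rank w' t)%R else 0%R.

(* A finite list containing all the symbols that are counted: the recurrences *)
(* below change D, n and the number of pairs, but stay within it.             *)
Definition universe (K n0 : nat) : seq pairs :=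
  [seq [seq (parts ab.1, parts ab.2) | ab <- t]
  | t : K.-bseq (bounded n0 * bounded n0)].

Lemma universe_uniq K n0 : uniq (universe K n0).
Proof.
rewrite map_inj_uniq ?enum_uniq // => s t /inj_map eqst.
by apply/val_inj/eqst => -[a b] [a' b'] [/parts_inj -> /parts_inj ->].
Qed.

Lemma mem_universe K n0 (x : pairs) :
  size x <= K -> all (fun ab => is_partition ab.1 && is_partition ab.2) x ->
  weight x <= n0 -> x \in universe K n0.
Proof.
move=> szx px wx.
have [u uE] : exists u : seq (bounded n0 * bounded n0),
    [seq (parts c.1, parts c.2) | c <- u] = x.
  elim: x px wx {szx} => [|[a b] x IH] /=; first by exists [::].
  case/andP=> /andP[pa pb] px; rewrite /weight /= => wx.
  have [|u <-] := IH px; first by rewrite /weight; lia.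
  have [|a' <-] := bounded_onto (n := n0) pa; first lia.
  have [|b' <-] := bounded_onto (n := n0) pb; first lia.
  by exists ((a', b') :: u).
have szu : size u <= K by rewrite -(size_map (fun c => (parts c.1, parts c.2))) uE.
by apply/mapP; exists (Bseq szu); rewrite ?mem_enum.
Qed.

Lemma in_range_partition lo hi p : 0 < lo -> in_range lo hi p -> is_partition p.
Proof.
move=> lo0 /andP[/path_sorted sp ap]; rewrite /is_partition sp.
by apply: sub_all ap => x; apply: leq_trans.
Qed.

Lemma in_range_le lo hi hi' p : hi <= hi' -> in_range lo hi p -> in_range lo hi' p.
Proof.
move=> le /andP[pp ap]; rewrite /in_range ap andbT.
by case: p pp {ap} => //= y p /andP[yh ->]; rewrite andbT; lia.
Qed.

Lemma in_range_cons lo D p : lo <= D -> in_range lo D (D :: p) = in_range lo D p.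
Proof. by move=> lD; rewrite /in_range /= /geq /= leqnn lD. Qed.

Lemma in_range_drop lo D p : 0 < D -> in_range lo D p -> head 0 p != D ->
  in_range lo D.-1 p.
Proof.
move=> D0 /andP[pp ap]; rewrite /in_range ap andbT.
by case: p pp {ap} => //= y p /andP[yD ->]; rewrite /geq /= in yD *; lia.
Qed.

Lemma in_range_nil lo hi p : hi < lo -> in_range lo hi p -> p = [::].
Proof.
by case: p => // y p lt /andP[/= /andP[yh _] /andP[ly _]]; rewrite /geq /= in yh; lia.
Qed.

Lemma in_range_head lo D p : 0 < D -> in_range lo D.-1 p -> head 0 p != D.
Proof.
by case: p => [|y p] /= D0; rewrite /in_range /=; [lia | rewrite /geq /=; lia].
Qed.

Lemma in_range_low lo lo' hi p : lo' <= lo -> in_range lo hi p -> in_range lo' hi p.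
Proof.
move=> le /andP[pp ap]; rewrite /in_range pp.
by apply: sub_all ap => x; apply: leq_trans.
Qed.

Lemma top_wf_range D a b t : top_wf D a b t -> in_range 1 D a && in_range 1 D b.
Proof.
case: t => [|[[|M ma] b'] t] //= /and5P[M0 MD ra rb _].
by rewrite !(in_range_low M0).
Qed.

Lemma wf_partitions D x : wf D x ->
  all (fun ab => is_partition ab.1 && is_partition ab.2) x.
Proof.
case: x => //= -[a b] t; elim: t D a b => [|[[|M a'] b'] t IH] D a b //=.
  by case/andP=> /in_range_partition -> // /in_range_partition ->.
case/and5P=> M0 MD ra rb ok; have /andP[_ rb'] := top_wf_range ok.
rewrite (in_range_partition M0 ra) (in_range_partition M0 rb) /=.
have /= /andP[/andP[pa' ->] ->] := IH _ _ _ ok; rewrite !andbT.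
apply: (@in_range_partition 1 M) => //.
by rewrite in_range_cons //; case/andP: (top_wf_range ok).
Qed.

Lemma top_wf_consl D a b t : 0 < D -> top_wf D (D :: a) b t = top_wf D a b t.
Proof.
move=> D0; case: t => [|[[|M ma] b'] t] //=; first by rewrite in_range_cons.
by case: (leqP M D) => //= MD; rewrite in_range_cons.
Qed.

Lemma top_wf_consr D a b t : 0 < D -> top_wf D a (D :: b) t = top_wf D a b t.
Proof.
move=> D0; case: t => [|[[|M ma] b'] t] //=; first by rewrite in_range_cons.
by case: (leqP M D) => //= MD; rewrite in_range_cons.
Qed.

(** * The recurrence from removing entries equal to the bound *)

(* w marks the pairs, from top to bottom, whose ranks are tracked. *)
Definition marked (w : seq bool) (D : nat) (n m : int) (x : pairs) : bool :=
  [&& wf D x, size x == size w, (weight x)%:Z%R == n & tracked_rank w x == m].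

Definition marked_count (K n0 : nat) (w : seq bool) (D : nat) (n m : int) : nat :=
  count (marked w D n m) (universe K n0).

Lemma marked_universe K n0 w D (n m : int) x : size w <= K -> (n <= n0%:Z)%R ->
  marked w D n m x -> x \in universe K n0.
Proof.
move=> wK nn0 /and4P[wfx /eqP sx /eqP wx _].
by apply: mem_universe (wf_partitions wfx) _; lia.
Qed.

Definition alpha_top (D : nat) (x : pairs) : bool :=
  if x is (a, _) :: _ then head 0 a == D else false.

Definition beta_top (D : nat) (x : pairs) : bool :=
  if x is (_, b) :: _ then head 0 b == D else false.

(** The largest part of the second top row bounds the top pair from below; when it is [D], the top
    pair can only have parts [D]. *)
Definition mark_top (D : nat) (x : pairs) : bool :=
  if x is _ :: (a, _) :: _ then head 0 a == D else false.

Definition alpha_push (D : nat) (x : pairs) : pairs :=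
  if x is (a, b) :: t then (D :: a, b) :: t else x.

Definition beta_push (D : nat) (x : pairs) : pairs :=
  if x is (a, b) :: t then (a, D :: b) :: t else x.

Definition alpha_pop (x : pairs) : pairs :=
  if x is (a, b) :: t then (behead a, b) :: t else x.

Definition beta_pop (x : pairs) : pairs :=
  if x is (a, b) :: t then (a, behead b) :: t else x.

Lemma alpha_pushK D : cancel (alpha_push D) alpha_pop.
Proof. by case=> [|[a b] t]. Qed.

Lemma beta_pushK D : cancel (beta_push D) beta_pop.
Proof. by case=> [|[a b] t]. Qed.

Lemma alpha_popK D x : 0 < D -> alpha_top D x -> alpha_push D (alpha_pop x) = x.
Proof. by case: x => [|[[|y a] b] t] //= D0 /eqP e; [lia | rewrite e]. Qed.

Lemma beta_popK D x : 0 < D -> beta_top D x -> beta_push D (beta_pop x) = x.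
Proof. by case: x => [|[a [|y b]] t] //= D0 /eqP e; [lia | rewrite e]. Qed.

Lemma marked_alpha_push (c : bool) w D n m x : 0 < D ->
  marked (c :: w) D n m (alpha_push D x) =
  marked (c :: w) D (n - D%:Z)%R (m - c%:Z)%R x.
Proof.
case: x => [|[a b] t] //= D0; rewrite /marked /tracked_rank /= top_wf_consl // /weight /length_diff /=.
by congr [&& _, _, _ & _]; apply/eqP/eqP; case: (c) => /=; lia.
Qed.

Lemma marked_beta_push (c : bool) w D n m x : 0 < D ->
  marked (c :: w) D n m (beta_push D x) =
  marked (c :: w) D (n - D%:Z)%R (m + c%:Z)%R x.
Proof.
case: x => [|[a b] t] //= D0; rewrite /marked /tracked_rank /= top_wf_consr // /weight /length_diff /=.
by congr [&& _, _, _ & _]; apply/eqP/eqP; case: (c) => /=; lia.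
Qed.

Lemma alpha_top_push D x : x != [::] -> alpha_top D (alpha_push D x).
Proof. by case: x => [|[a b] t] //= _; rewrite eqxx. Qed.

Lemma beta_top_push D x : x != [::] -> beta_top D (beta_push D x).
Proof. by case: x => [|[a b] t] //= _; rewrite eqxx. Qed.

Lemma alpha_top_beta_push D x : alpha_top D (beta_push D x) = alpha_top D x.
Proof. by case: x => [|[a b] t]. Qed.

Lemma marked_nil w D n m x : marked w D n m x -> x != [::].
Proof. by case: x. Qed.

Section Recurrence.
Context (K n0 : nat) (c : bool) (w : seq bool) (D : nat) (n : int).
Context (wK : size (c :: w) <= K) (nn0 : (n <= n0%:Z)%R) (D0 : 0 < D).

Lemma count_alpha_top m :
  count (predI (marked (c :: w) D n m) (alpha_top D)) (universe K n0) =
  marked_count K n0 (c :: w) D (n - D%:Z)%R (m - c%:Z)%R.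
Proof.
apply: (@count_bij _ _ _ _ _ _ alpha_pop (alpha_push D));
  rewrite ?universe_uniq // => x _.
  case/andP=> mx tx; have xE := alpha_popK D0 tx.
  have mx' : marked (c :: w) D (n - D%:Z)%R (m - c%:Z)%R (alpha_pop x).
    by rewrite -marked_alpha_push // xE.
  by split=> //; apply: marked_universe wK _ mx'; lia.
move=> mx; have mx' : marked (c :: w) D n m (alpha_push D x).
  by rewrite marked_alpha_push.
split; [exact: marked_universe mx'| |exact: alpha_pushK].
by rewrite /= mx' alpha_top_push // (marked_nil mx).
Qed.

(** [Q] allows the removal to take place among the symbols whose top row alpha has no part [D]. *)
Lemma count_beta_top (Q : pred pairs) m :
  (forall x, Q (beta_push D x) = Q x) ->
  count (predI (marked (c :: w) D n m) (predI (beta_top D) Q)) (universe K n0) =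
  count (predI (marked (c :: w) D (n - D%:Z)%R (m + c%:Z)%R) Q) (universe K n0).
Proof.
move=> QE; apply: (@count_bij _ _ _ _ _ _ beta_pop (beta_push D));
  rewrite ?universe_uniq // => x _.
  case/and3P=> mx tx Qx; have xE := beta_popK D0 tx.
  have mx' : marked (c :: w) D (n - D%:Z)%R (m + c%:Z)%R (beta_pop x).
    by rewrite -marked_beta_push // xE.
  split=> //; first by apply: marked_universe wK _ mx'; lia.
  by rewrite /= mx' -QE xE.
case/andP=> mx Qx; have mx' : marked (c :: w) D n m (beta_push D x).
  by rewrite marked_beta_push.
split; [exact: marked_universe mx'| |exact: beta_pushK].
by rewrite /= mx' beta_top_push ?QE // (marked_nil mx).
Qed.

(** Every entry of the chain is bounded by the top pair's bound or by the mark of the second pair,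
    so if none of these reaches [D], the bound can be lowered. *)
Lemma marked_lower m x :
  [&& marked (c :: w) D n m x, ~~ alpha_top D x, ~~ beta_top D x
    & ~~ mark_top D x] = marked (c :: w) D.-1 n m x.
Proof.
case: x => [|[a b] t] //=; rewrite /marked /=.
suff -> : top_wf D.-1 a b t = [&& top_wf D a b t, head 0 a != D, head 0 b != D
    & ~~ mark_top D ((a, b) :: t)].
  by rewrite /=; case: (top_wf D a b t); rewrite ?andbF ?andbT //= -!andbA; do !bool_congr.
have D1 : D.-1 <= D by lia.
case: t => [|[[|M a'] b'] t] //=.
  apply/idP/idP=> [/andP[ra rb]|/and4P[/andP[ra rb] ha hb _]]; last first.
    by rewrite !in_range_drop.
  by rewrite (in_range_le D1 ra) (in_range_le D1 rb) !(@in_range_head 1).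
apply/idP/idP=> [/and5P[M0 MD ra rb ok]|].
  rewrite M0 (in_range_le D1 ra) (in_range_le D1 rb) ok !(@in_range_head M) //=.
  by lia.
case/and4P=> /and5P[-> MD ra rb ->] ha hb hM.
by rewrite !in_range_drop //= !andbT; lia.
Qed.

(** The parts of the top pair lie between the mark and [D]; if the mark is [D] and neither row
    starts with [D], both rows are empty. The top pair is dropped together with the mark, and losing
    the mark accounts for the -1 in the rank of the next pair. *)
Lemma count_mark_top m :
  count (predI (marked (c :: w) D n m)
    (predI (mark_top D) (predI (predC (alpha_top D)) (predC (beta_top D)))))
    (universe K n0) = marked_count K n0 w D (n - D%:Z)%R m.
Proof.
pose f (x : pairs) : pairs := if x is _ :: t then alpha_pop t else [::].
pose g (x : pairs) : pairs := ([::], [::]) :: alpha_push D x.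
apply: (@count_bij _ _ _ _ _ _ f g); rewrite ?universe_uniq //.
  case=> [|[a b] [|[[|M a'] b'] t]] _ //=; rewrite ?andbF //.
case/and4P=> mx /eqP eM ha hb; move: mx.
  rewrite eM /marked /tracked_rank /weight /= => /and4P[/and5P[_ _ ra rb ok] sx wx rx].
  have D1 : D.-1 < D by lia.
  have a0 : a = [::] by apply: in_range_nil D1 (in_range_drop D0 ra ha).
  have b0 : b = [::] by apply: in_range_nil D1 (in_range_drop D0 rb hb).
  rewrite a0 b0 in sx wx rx *.
  have mx' : marked w D (n - D%:Z)%R m ((a', b') :: t).
    rewrite /marked /tracked_rank /= ok /weight /=; move: wx rx sx.
    by case: (w) => [|c' w'] //= /eqP wx /eqP rx /eqP sx;
      rewrite /length_diff /= in rx *; lia.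
  by split=> //; apply: marked_universe mx'; [move: wK => /=; lia | lia].
move=> x _ mx; have mx' : marked (c :: w) D n m (g x).
  move: mx; rewrite /g /marked /tracked_rank /weight; case: x => [|[a b] t] //=.
  rewrite leqnn D0 /in_range /= => /and4P[-> + /eqP wx].
  by case: (w) => [|c' w'] //= sx /eqP rx; rewrite /length_diff /= in rx *; lia.
split; [exact: marked_universe mx'| |].
  by rewrite /= mx' /=; move: mx; case: x {mx'} => [|[a b] t] //= _; rewrite eqxx /=; lia.
by rewrite /f /g alpha_pushK.
Qed.

End Recurrence.

Lemma count_split (T : Type) (P Q : pred T) s :
  count P s = count (predI P Q) s + count (predI P (predC Q)) s.
Proof. by elim: s => //= x s ->; case: (P x); case: (Q x) => /=; lia. Qed.

(* Coefficientwise, (1 - z q^D)(1 - z^-1 q^D) F(c :: w, D) = F(c :: w, D - 1) *)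
(* + q^D F(w, D), where z marks the rank of the top pair when it is tracked   *)
(* and z = 1 otherwise. *)
Lemma marked_count_rec K n0 (c : bool) w D (n m : int) :
  size (c :: w) <= K -> (n <= n0%:Z)%R -> 0 < D ->
  ((marked_count K n0 (c :: w) D n m)%:Z =
     (marked_count K n0 (c :: w) D (n - D%:Z) (m - c%:Z))%:Z
   + (marked_count K n0 (c :: w) D (n - D%:Z) (m + c%:Z))%:Z
   - (marked_count K n0 (c :: w) D (n - D%:Z - D%:Z) m)%:Z
   + (marked_count K n0 (c :: w) D.-1 n m)%:Z
   + (marked_count K n0 w D (n - D%:Z) m)%:Z)%R.
Proof.
move=> wK nn0 D0; have nD : (n - D%:Z <= n0%:Z)%R by lia.
have A := count_alpha_top wK nn0 D0 m.
(* The beta term ranges only over symbols without [D] in alpha. The others are counted here, their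
   two rank shifts cancel, and they become the negative term of the recurrence. *)
have A' := count_alpha_top wK nD D0 (m + c%:Z)%R.
have B := count_beta_top wK nn0 D0 (Q := predC (alpha_top D)) m
  (fun x => congr1 negb (alpha_top_beta_push D x)).
have M := count_mark_top wK nn0 D0 m.
rewrite addrK in A'.
have S1 := count_split (marked (c :: w) D n m) (alpha_top D) (universe K n0).
have S2 := count_split (predI (marked (c :: w) D n m) (predC (alpha_top D)))
  (beta_top D) (universe K n0).
have S3 := count_split (predI (predI (marked (c :: w) D n m)
  (predC (alpha_top D))) (predC (beta_top D))) (mark_top D) (universe K n0).
have S4 := count_split (marked (c :: w) D (n - D%:Z) (m + c%:Z))%R
  (alpha_top D) (universe K n0).
have eB : count (predI (predI (marked (c :: w) D n m) (predC (alpha_top D)))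
    (beta_top D)) (universe K n0) =
    count (predI (marked (c :: w) D n m) (predI (beta_top D)
      (predC (alpha_top D)))) (universe K n0).
  by apply: eq_count => x /=; case: marked; case: alpha_top; case: beta_top.
have eM : count (predI (predI (predI (marked (c :: w) D n m)
    (predC (alpha_top D))) (predC (beta_top D))) (mark_top D)) (universe K n0) =
    count (predI (marked (c :: w) D n m) (predI (mark_top D)
      (predI (predC (alpha_top D)) (predC (beta_top D))))) (universe K n0).
  by apply: eq_count => x /=; case: marked; case: alpha_top; case: beta_top; case: mark_top.
have eL : count (predI (predI (predI (marked (c :: w) D n m)
    (predC (alpha_top D))) (predC (beta_top D))) (predC (mark_top D)))
    (universe K n0) = marked_count K n0 (c :: w) D.-1 n m.
  apply: eq_count => x; rewrite -(marked_lower wK nn0 D0) /=.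
  by case: marked; case: alpha_top; case: beta_top; case: mark_top.
rewrite -/(marked_count K n0 (c :: w) D n m) in S1.
rewrite -/(marked_count K n0 (c :: w) D (n - D%:Z)%R (m + c%:Z)%R) A' in S4.
rewrite {1}S1 A S2 S3 eB eM eL B M; lia.
Qed.

(** * Vanishing of the counts *)

Lemma marked_count_eq0 K n0 w D (n m : int) :
  (forall x, ~~ marked w D n m x) -> marked_count K n0 w D n m = 0.
Proof. by move=> no; apply/eqP; rewrite -leqn0 leqNgt -has_count; apply/hasPn. Qed.

Lemma marked_count_neg K n0 w D (n m : int) : (n < 0)%R ->
  marked_count K n0 w D n m = 0.
Proof. by move=> n_lt0; apply: marked_count_eq0 => x; apply/and4P=> -[_ _ /eqP e _]; lia. Qed.

Lemma lower_rank_untracked j t : lower_rank (nseq j false) t = 0%R.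
Proof. by elim: j t => [|j IH] [|ab t] //=; rewrite mul0r add0r IH. Qed.

(** Under the bound 0 only a single empty pair is possible, and its rank is 0 with or without a
    mark. *)
Lemma marked_side0 w w' n m x : size w = size w' ->
  marked w 0 n m x = marked w' 0 n m x.
Proof.
move=> ww'; rewrite /marked ww'; case wfx: (wf 0 x) => //=.
case: x wfx => //= -[a b] [|[[|M a'] b'] t] //=; last first.
  by case/and3P=> M0 M0'; lia.
case/andP=> /in_range_nil -> // /in_range_nil -> //.
congr [&& _, _ & _]; rewrite /tracked_rank.
by case: w w' ww' => [|c [|? w]] [|c' [|? w']] //=; rewrite /length_diff /= subrr !mulr0.
Qed.

Lemma marked_count_side0 K n0 w w' n m : size w = size w' ->
  marked_count K n0 w 0 n m = marked_count K n0 w' 0 n m.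
Proof. by move=> ww'; apply: eq_count => x; apply: marked_side0. Qed.

Lemma marked_count_side0_eq0 K n0 w n m : 1 < size w ->
  marked_count K n0 w 0 n m = 0.
Proof.
move=> w1; apply: marked_count_eq0 => x; apply/negP => /and4P[+ /eqP sx _ _].
case: x sx => [|[a b] [|[[|M a'] b'] t]] //=; first by lia.
by move=> _ /and3P[M0 M0']; lia.
Qed.

Lemma marked_count_untracked K n0 j D n m : m != 0%R ->
  marked_count K n0 (nseq j false) D n m = 0.
Proof.
move=> m0; apply: marked_count_eq0 => x; apply: contra m0 => /and4P[_ _ _ /eqP <-].
have low i t : lower_rank (nseq i false) t = 0%R.
  by elim: i t => [|i IH] [|ab t] //=; rewrite mul0r add0r IH.
by case: j x => [|j] [|ab t]; rewrite /tracked_rank //= lower_rank_untracked mul0r.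
Qed.

(** A rank is at least minus the number of parts of beta, hence minus its weight; in a lower pair
    the nonempty alpha makes up for the -1. *)
Lemma lower_rank_ge w D a b t : top_wf D a b t -> (- (weight t)%:Z <= lower_rank w t)%R.
Proof.
elim: t w D a b => [|[[|M a'] b'] t IH] [|c w] D a b //=.
  by move=> _; lia.
case/and5P=> M0 MD ra rb ok; have := IH w _ _ _ ok.
have /andP[_ /andP[_ /size_le_sumn]] := top_wf_range ok.
by rewrite /weight /length_diff /=; case: c => /=; lia.
Qed.

Lemma tracked_rank_ge w D x : wf D x -> (- (weight x)%:Z <= tracked_rank w x)%R.
Proof.
case: w x => [|c w] [|[a b] t] //= ok; first by rewrite /tracked_rank; lia.
have := lower_rank_ge w ok.
have /andP[_ /andP[_ /size_le_sumn]] := top_wf_range ok.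
by rewrite /weight /tracked_rank /length_diff /=; case: c => /=; lia.
Qed.

Lemma marked_count_large K n0 w D n m : (m < - n)%R ->
  marked_count K n0 w D n m = 0.
Proof.
move=> mn; apply: marked_count_eq0 => x; apply/negP=> /and4P[ok _ /eqP wx /eqP rx].
by have := tracked_rank_ge w ok; lia.
Qed.

(** * The divided difference relation *)

Lemma marked_count_rec_tracked K n0 w D (n m : int) :
  size (true :: w) <= K -> (n <= n0%:Z)%R -> 0 < D ->
  ((marked_count K n0 (true :: w) D n m)%:Z =
     (marked_count K n0 (true :: w) D (n - D%:Z) (m - 1))%:Z
   + (marked_count K n0 (true :: w) D (n - D%:Z) (m + 1))%:Z
   - (marked_count K n0 (true :: w) D (n - D%:Z - D%:Z) m)%:Z
   + (marked_count K n0 (true :: w) D.-1 n m)%:Z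
   + (marked_count K n0 w D (n - D%:Z) m)%:Z)%R.
Proof. exact: marked_count_rec. Qed.

Lemma marked_count_rec_untracked K n0 w D (n m : int) :
  size (false :: w) <= K -> (n <= n0%:Z)%R -> 0 < D ->
  ((marked_count K n0 (false :: w) D n m)%:Z =
   2%:Z * (marked_count K n0 (false :: w) D (n - D%:Z) m)%:Z
   - (marked_count K n0 (false :: w) D (n - D%:Z - D%:Z) m)%:Z
   + (marked_count K n0 (false :: w) D.-1 n m)%:Z
   + (marked_count K n0 w D (n - D%:Z) m)%:Z)%R.
Proof.
move=> wK nn0 D0; have := marked_count_rec m wK nn0 D0.
have -> : (m + (false : nat)%:Z = m)%R by lia.
lia.
Qed.

(* w has one more node 2 than w1; w2 is w without its node s. *)
Inductive divided : seq bool -> seq bool -> seq bool -> Prop :=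
| divided_tracked u : divided (true :: false :: u) (true :: u) (false :: u)
| divided_untracked u : divided (false :: true :: u) (true :: u) (false :: u)
| divided_cons w w1 w2 :
    divided w w1 w2 -> divided (false :: w) (false :: w1) (false :: w2).

Lemma divided_size w w1 w2 : divided w w1 w2 ->
  [/\ 0 < size w1, size w1 = size w2 & size w = (size w1).+1].
Proof. by elim=> //= {}w {}w1 {}w2 _ [_ -> ->]. Qed.

(** Induction on [divided], on [D], and on a bound [N] for the weight, since the recurrence returns
    to the same [D] at smaller weight. The difference of the two sides satisfies the recurrence of
    [w]. In the first two cases the terms from dropping the top pair cancel against the discrepancy
    between the tracked and untracked recurrences; under [divided_cons] they form the same relation
    for the tails. *)
Lemma marked_count_divided K n0 w w1 w2 D (n m : int) :
  divided w w1 w2 -> size w <= K -> (n <= n0%:Z)%R ->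
  (2%:Z * (marked_count K n0 w D n m)%:Z - (marked_count K n0 w D n (m - 1))%:Z
     - (marked_count K n0 w D n (m + 1))%:Z =
   (marked_count K n0 w2 D n m)%:Z - (marked_count K n0 w1 D n m)%:Z)%R.
Proof.
move=> ww; elim: ww D n m => {w w1 w2} [u|u|w w1 w2 ww IHw] D n m wK nn0;
  (have [N nN] : exists N : nat, (n < N%:Z)%R by exists `|n|.+1%N; lia);
  elim: D N n m nN nn0 => [|D IHD] N n m.
(* Two pairs do not fit under the bound 0, and there the counts for [w1] and [w2] agree. *)
- by move=> *; rewrite !(@marked_count_side0_eq0 _ _ [:: true, false & u]) //
    (@marked_count_side0 _ _ (true :: u) (false :: u)) //; lia.
- elim: N n m => [|N IHN] n m nN nn0.
    by rewrite !marked_count_neg; lia.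
  have D0 : 0 < D.+1 by [].
  have nD : (n - D.+1%:Z <= n0%:Z)%R by lia.
  have wK' : size (true :: u) <= K by rewrite /= in wK *; lia.
  have X1 := marked_count_rec_tracked (m - 1)%R wK nn0 D0.
  have X2 := marked_count_rec_tracked m wK nn0 D0.
  have X3 := marked_count_rec_tracked (m + 1)%R wK nn0 D0.
  have A := @marked_count_rec_untracked _ _ _ _ n m wK' nn0 D0.
  have B := marked_count_rec_tracked m wK' nn0 D0.
  have I := IHD N.+1 n m nN nn0.
  have I1 : (n - D.+1%:Z < N%:Z)%R by lia.
  have I2 : (n - D.+1%:Z - D.+1%:Z < N%:Z)%R by lia.
  have nDD : (n - D.+1%:Z - D.+1%:Z <= n0%:Z)%R by lia.
  have J1 := IHN _ (m - 1)%R I1 nD.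
  have J2 := IHN _ (m + 1)%R I1 nD.
  have J3 := IHN _ m I2 nDD.
  rewrite ?subrK ?addrK /= in X1 X2 X3 A B I J1 J2 J3 *.
  lia.
- by move=> *; rewrite !(@marked_count_side0_eq0 _ _ [:: false, true & u]) //
    (@marked_count_side0 _ _ (true :: u) (false :: u)) //; lia.
- elim: N n m => [|N IHN] n m nN nn0.
    by rewrite !marked_count_neg; lia.
  have D0 : 0 < D.+1 by [].
  have wK' : size (true :: u) <= K by rewrite /= in wK *; lia.
  have X1 := marked_count_rec_untracked (m - 1)%R wK nn0 D0.
  have X2 := marked_count_rec_untracked m wK nn0 D0.
  have X3 := marked_count_rec_untracked (m + 1)%R wK nn0 D0.
  have A := @marked_count_rec_untracked _ _ _ _ n m wK' nn0 D0.
  have B := marked_count_rec_tracked m wK' nn0 D0.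
  have I := IHD N.+1 n m nN nn0.
  have I1 : (n - D.+1%:Z < N%:Z)%R by lia.
  have I2 : (n - D.+1%:Z - D.+1%:Z < N%:Z)%R by lia.
  have nD : (n - D.+1%:Z <= n0%:Z)%R by lia.
  have nDD : (n - D.+1%:Z - D.+1%:Z <= n0%:Z)%R by lia.
  have J1 := IHN _ m I1 nD.
  have J3 := IHN _ m I2 nDD.
  rewrite ?subrK ?addrK /= in X1 X2 X3 A B I J1 J3 *.
  lia.
- have [w0 ww2 ww1] := divided_size ww.
  by move=> *; rewrite !marked_count_side0_eq0 //=; lia.
elim: N n m => [|N IHN] n m nN nn0.
  by rewrite !marked_count_neg; lia.
have [w0 ww2 ww1] := divided_size ww.
have D0 : 0 < D.+1 by [].
have K0 : size w <= K by rewrite /= in wK; lia.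
have K1 : size (false :: w1) <= K by rewrite /= in wK *; lia.
have K2 : size (false :: w2) <= K by rewrite /= in wK *; lia.
have X1 := marked_count_rec_untracked (m - 1)%R wK nn0 D0.
have X2 := marked_count_rec_untracked m wK nn0 D0.
have X3 := marked_count_rec_untracked (m + 1)%R wK nn0 D0.
have A := marked_count_rec_untracked m K1 nn0 D0.
have B := marked_count_rec_untracked m K2 nn0 D0.
have I := IHD N.+1 n m nN nn0.
have I1 : (n - D.+1%:Z < N%:Z)%R by lia.
have I2 : (n - D.+1%:Z - D.+1%:Z < N%:Z)%R by lia.
have nD : (n - D.+1%:Z <= n0%:Z)%R by lia.
have nDD : (n - D.+1%:Z - D.+1%:Z <= n0%:Z)%R by lia.
have J0 := IHw D.+1 _ m K0 nD.
have J1 := IHN _ m I1 nD.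
have J3 := IHN _ m I2 nDD.
rewrite /= in X1 X2 X3 A B I J0 J1 J3 *.
lia.
Qed.

(** * Repeated summation by parts *)

(** By Pascal's rule, the second difference in [m] of ['C(m + j, 2j + 2)] is ['C(m + j - 1, 2j)].
    Nothing is left at the lower end, because ['C(j, 2j + 2)] and ['C(j + 1, 2j + 2)] are 0. *)
Lemma sum_by_parts j N (f g : nat -> int) :
  (forall m : nat, (0 < m <= N)%N -> g m = f m.+1 + f m.-1 - 2%:Z * f m)%R ->
  (\sum_(1 <= m < N.+1) 'C(m + j, j.+1.*2)%:Z * g m =
   \sum_(1 <= m < N.+1) 'C(m + j - 1, j.*2)%:Z * f m
   + 'C(N + j, j.+1.*2)%:Z * f N.+1 - 'C(N + j.+1, j.+1.*2)%:Z * f N)%R.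
Proof.
elim: N => [|N IH] gE.
  by rewrite !big_nil !bin_small ?mul0r ?subr0 ?addr0 //; lia.
rewrite !(@big_nat_recr _ _ _ N.+1) //= IH; last by move=> m mN; apply: gE; lia.
rewrite gE ?ltnS ?leqnn //= doubleS !addSn !addnS !binS subn1 /=.
by rewrite !PoszD; ring.
Qed.

Lemma divided_insert b u :
  divided (nseq b.+1 false ++ true :: u) (nseq b false ++ true :: u)
    (nseq b.+1 false ++ u).
Proof. by elim: b => [|b IH] /=; constructor. Qed.

(* The tracked pair has b pairs above it and a pairs below it. *)
Definition tracking (a b : nat) : seq bool := nseq b false ++ true :: nseq a false.

Lemma size_tracking a b : size (tracking a b) = (a + b).+1.
Proof. by rewrite size_cat /= !size_nseq addnS addnC. Qed.

(** The dropped untracked pair is taken from above the tracked one if possible, otherwise from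
    below. *)
Lemma divided_tracking k a b : a + b = k.+1 ->
  exists a' b', a' + b' = k /\
    divided (tracking a b) (tracking a' b') (nseq k.+1 false).
Proof.
case: b => [|b] abk.
  exists k, 0; split; first lia.
  by rewrite addn0 in abk; rewrite abk /tracking /=; constructor.
exists a, b; split; first lia.
have -> : nseq k.+1 false = nseq b.+1 false ++ nseq a false.
  by rewrite -abk addnC nseqD.
exact: divided_insert.
Qed.

(** Each step drops an untracked pair and raises [j], so [k + j] is constant. At negative rank the
    count without marks is 0, and the shorter count is the second difference of the longer one. *)
Lemma marked_count_moments K n0 D k a b j N (n : int) : a + b = k -> k < K ->
  (n <= n0%:Z)%R -> (n < N%:Z)%R ->
  (\sum_(1 <= m < N.+1) 'C(m + j - 1, j.*2)%:Z *
     (marked_count K n0 (tracking a b) D n (- m%:Z))%:Z =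
   \sum_(1 <= m < N.+1) 'C(m + (k + j) - 1, (k + j).*2)%:Z *
     (marked_count K n0 [:: true] D n (- m%:Z))%:Z)%R.
Proof.
elim: k a b j => [|k IH] a b j abk kK nn0 nN.
  by have [-> ->] : a = 0 /\ b = 0 by lia.
have [a' [b' [abk' div]]] := divided_tracking abk.
have szw : size (tracking a b) <= K by rewrite size_tracking abk.
(* This kills the boundary terms at [N] and [N.+1]. *)
have large w i : N <= i -> marked_count K n0 w D n (- i%:Z) = 0.
  by move=> Ni; rewrite marked_count_large //; lia.
rewrite addSnnS -(IH a' b' j.+1 abk' (ltnW kK) nn0 nN).
under [RHS]eq_bigr => m _ do rewrite addnS subn1 /=.
rewrite (@sum_by_parts _ _ (fun m => (marked_count K n0 (tracking a b) D n (- m%:Z))%:Z)%R).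
  by rewrite !large ?mulr0 ?subr0 ?addr0 //; lia.
move=> m /andP[m0 _] /=.
have := marked_count_divided D (- m%:Z)%R div szw nn0.
rewrite marked_count_untracked; last by lia.
have -> : (- m%:Z - 1 = - m.+1%:Z)%R by lia.
have -> : (- m%:Z + 1 = - m.-1%:Z)%R by lia.
lia.
Qed.

Definition negative (w : seq bool) (D : nat) (n : int) (x : pairs) : bool :=
  [&& wf D x, size x == size w, (weight x)%:Z%R == n & (tracked_rank w x < 0)%R].

(** The case [j = 0] of the moments, where the coefficient ['C(m - 1, 0)] is 1. *)
Lemma count_negative K n0 D k a b N (n : int) : a + b = k -> k < K ->
  (n <= n0%:Z)%R -> (n < N%:Z)%R ->
  count (negative (tracking a b) D n) (universe K n0) =
  \sum_(1 <= m < N.+1) 'C(m + k - 1, k.*2) *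
     marked_count K n0 [:: true] D n (- m%:Z)%R.
Proof.
move=> abk kK nn0 nN.
have := marked_count_moments D 0 abk kK nn0 nN; rewrite addn0 => E.
rewrite (@count_classes _ _ (fun x => `|tracked_rank (tracking a b) x|) 1 N.+1).
  apply/eqP; rewrite -eqz_nat !(big_morph Posz PoszD (erefl _)); apply/eqP.
  under [RHS]eq_bigr => m _ do rewrite PoszM.
  rewrite -E; apply: eq_big_nat => m /andP[m0 _].
  rewrite bin0 mul1r; congr Posz; apply: eq_count => x.
  rewrite /negative /marked -!andbA; do 3 bool_congr; apply/andP/eqP; lia.
move=> x /and4P[ok _ /eqP wx rx].
by have := tracked_rank_ge (tracking a b) ok; lia.
Qed.

(** * Conjugation and Durfee squares *)

(** The first [r] column lengths of the diagram, padded with zeros: fewer than [D] rows may extend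
    to the right of a Durfee square of side [D]. *)
Definition conjugate (r : nat) (p : seq nat) : seq nat :=
  mkseq (fun i => count (fun y => i < y) p) r.

Lemma size_conjugate r p : size (conjugate r p) = r.
Proof. exact: size_mkseq. Qed.

(** Both sides say that the cell in row [j] and column [i] lies in the diagram. *)
Lemma ltn_count_sorted p i j : sorted geq p ->
  (j < count (fun y => i < y) p) = (i < nth 0 p j).
Proof.
elim: p j => [|y p IH] j /= pp; first by rewrite nth_nil.
have sp := path_sorted pp.
case: j => [|j] /=; case: (ltnP i y) => iy //=.
- rewrite add0n -has_count; apply/negbTE/negP => /hasP[z zp iz].
  have /allP/(_ z zp) := order_path_min (fun a b c ab bc => leq_trans bc ab) pp.
  by rewrite /geq /= => zy; lia.
- by rewrite add1n ltnS IH.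
rewrite add0n -IH //; apply/idP/idP; first exact: ltnW.
have -> // : count (fun y => i < y) p = 0.
apply/eqP; rewrite -leqn0 leqNgt -has_count; apply/hasP => -[z zp iz].
have /allP/(_ z zp) := order_path_min (fun a b c ab bc => leq_trans bc ab) pp.
by rewrite /geq /= => zy; lia.
Qed.

Lemma count_ltn_iota v s : count (fun i => i < v) (iota 0 s) = minn v s.
Proof.
elim: s => [|s IH]; first by rewrite minn0.
by rewrite -addn1 iotaD count_cat IH /=; lia.
Qed.

(** Zeros in [p] are recovered too, as [size p] restores the number of rows. *)
Lemma conjugateK s p : sorted geq p -> all (fun y => y <= s) p ->
  conjugate (size p) (conjugate s p) = p.
Proof.
move=> sp /allP ps; apply: (@eq_from_nth _ 0) => [|j]; rewrite size_conjugate // => jp.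
rewrite nth_mkseq // count_map.
rewrite (eq_count (a2 := fun i => i < nth 0 p j)) => [|i /=]; last exact: ltn_count_sorted.
by rewrite count_ltn_iota; apply/minn_idPl/ps/mem_nth.
Qed.

Lemma sumn_conjugate s p : all (fun y => y <= s) p -> sumn (conjugate s p) = sumn p.
Proof.
rewrite sumnE big_map.
elim: p => [|y p IH] /= => [_|/andP[ys ps]]; first by rewrite big1.
rewrite big_split /= IH //; congr addn.
rewrite -[RHS](minn_idPl ys) -count_ltn_iota -sum1_count [RHS]big_mkcond /=.
by apply: eq_bigr => i _; case: (i < y).
Qed.

Lemma conjugate_sorted r p : sorted geq (conjugate r p).
Proof.
rewrite sorted_map; apply: (@sub_sorted _ leq); last exact: iota_sorted.
by move=> i j ij; apply: sub_count => y; apply: leq_trans.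
Qed.

Lemma conjugate_positive r p : sorted geq p -> r <= nth 0 p 0 -> all (leq 1) (conjugate r p).
Proof.
move=> sp rp; apply/allP => _ /mapP[i + ->]; rewrite mem_iota => /andP[_ ir].
by rewrite /= ltn_count_sorted //; lia.
Qed.

Lemma conjugate_le r p : all (fun y => y <= size p) (conjugate r p).
Proof. by apply/allP => _ /mapP[i _ ->]; apply: count_size. Qed.

Lemma head_conjugate r p : 0 < r -> all (leq 1) p -> head 0 (conjugate r p) = size p.
Proof. by case: r => // r _; rewrite all_count => /eqP. Qed.

Lemma in_rangeE lo hi p : in_range lo hi p =
  [&& sorted geq p, all (leq lo) p & all (fun y => y <= hi) p].
Proof.
rewrite /in_range; case: p => //= y p.
case yh: (y <= hi); rewrite ?andbF //=; case pp: (path geq y p) => //=.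
rewrite [X in _ = _ && X](_ : _ = true) ?andbT //.
apply: sub_all (order_path_min (fun a b c ab bc => leq_trans bc ab) pp) => z.
by rewrite /geq /= => zy; apply: leq_trans zy yh.
Qed.

(** Rows are indexed from 0, so the first row that does not pass the diagonal has the side of the
    square as its index. The search ends at [size p] at the latest, where [nth] returns 0. *)
Definition durfee (p : seq nat) : nat :=
  find (fun i => nth 0 p i <= i) (iota 0 (size p).+1).

Lemma durfeeP D p :
  durfee p = D <-> (forall i, i < D -> i < nth 0 p i) /\ nth 0 p D <= D.
Proof.
have hasd : has (fun i => nth 0 p i <= i) (iota 0 (size p).+1).
  apply/hasP; exists (size p); last by rewrite nth_default.
  by rewrite mem_iota /=; lia.
have ltd : durfee p < (size p).+1 by rewrite -[X in _ < X](size_iota 0) -has_find.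
have below i : i < durfee p -> i < nth 0 p i.
  move=> id; have := before_find 0 id; rewrite nth_iota ?add0n; lia.
have at_d : nth 0 p (durfee p) <= durfee p.
  by have := nth_find 0 hasd; rewrite nth_iota.
split=> [<- //|[belowD atD]].
case: (ltngtP (durfee p) D) => // [/belowD|/below]; lia.
Qed.

Lemma card_count (T : finType) (T' : Type) (f : T -> T') (P : pred T') :
  #|[set x | P (f x)]| = count P [seq f x | x : T].
Proof. by rewrite count_map enumT cardsE cardE /enum_mem size_filter. Qed.

Lemma sumn_map_add d p : sumn [seq d + x | x <- p] = d * size p + sumn p.
Proof. by elim: p => //= [|x p ->]; lia. Qed.

(** Alpha holds the rows below the square, beta the columns to its right. *)
Definition of_durfee (D : nat) (x : pairs) : seq nat :=
  if x is (a, b) :: _ then [seq D + y | y <- conjugate D b] ++ a else [::].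

Definition to_durfee (D : nat) (p : seq nat) : pairs :=
  [:: (drop D p, conjugate (largest p - D) [seq y - D | y <- take D p])].

Lemma nth_sorted_le (p : seq nat) i j : sorted geq p -> i <= j -> nth 0 p j <= nth 0 p i.
Proof.
move=> sp ij; case: (ltnP j (size p)) => jp; last by rewrite nth_default.
apply: (sorted_leq_nth (leT := geq)) => //; last by rewrite inE; lia.
- by move=> a b c; rewrite /geq /=; lia.
- by move=> a; rewrite /geq /=.
Qed.

Lemma to_durfee_facts D p : sorted geq p -> all (leq 1) p -> 0 < D -> durfee p = D ->
  let q := [seq y - D | y <- take D p] in
  [/\ size q = D, p = [seq D + y | y <- q] ++ drop D p, sorted geq q,
      all (fun y => y <= largest p - D) q &
      nth 0 q 0 = largest p - D /\ D <= largest p].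
Proof.
move=> sp p1 D0 /durfeeP[above below].
have Dp : D <= size p.
  have := above D.-1; case: (ltnP D.-1 (size p)) => [|big]; first lia.
  by rewrite nth_default //; lia.
have szq : size (take D p) = D by rewrite size_takel.
have nq i : i < D -> nth 0 [seq y - D | y <- take D p] i = nth 0 p i - D.
  by move=> iD; rewrite (nth_map 0) ?szq // nth_take.
have geD i : i < D -> D <= nth 0 p i.
  move=> iD; have := above D.-1; have := @nth_sorted_le p i D.-1 sp; lia.
have lp : largest p = nth 0 p 0 by rewrite nth0.
split=> //.
- by rewrite size_map.
- rewrite -[LHS](cat_take_drop D); congr cat; rewrite -map_comp -[LHS]map_id.
  apply/eq_in_map => y /(nthP 0)[i]; rewrite szq => iD; rewrite nth_take // => <- /=.
  by have := geD i iD; lia.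
- rewrite sorted_map; apply: (@sub_sorted _ geq); last exact: take_sorted.
  by move=> x y /=; rewrite /geq /=; apply: leq_sub2r.
- apply/allP => _ /mapP[y /(nthP 0)[i + <-] ->]; rewrite szq => iD.
  by rewrite nth_take // lp leq_sub2r // nth_sorted_le.
by rewrite nq // lp; split=> //; apply: geD.
Qed.

Lemma of_to_durfee D p : sorted geq p -> all (leq 1) p -> 0 < D -> durfee p = D ->
  of_durfee D (to_durfee D p) = p.
Proof.
move=> sp p1 D0 pD; have [szq pE sq q_le _] := to_durfee_facts sp p1 D0 pD.
rewrite /= (_ : conjugate D _ = [seq y - D | y <- take D p]) -?pE //.
by rewrite -{1}szq conjugateK.
Qed.

Lemma to_durfee_marked n m D p : 0 < D -> is_partition_of n p -> rank p = m ->
  durfee p = D ->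
  marked [:: true] D (n%:Z - (D ^ 2)%:Z)%R (- m)%R (to_durfee D p).
Proof.
move=> D0 /andP[/andP[sp p1] /eqP pn] rp pD.
have [szq pE sq q_le [q0 lp]] := to_durfee_facts sp p1 D0 pD.
have /durfeeP[_ below] := pD.
set q := [seq y - D | y <- take D p] in szq pE sq q_le q0.
have sumE : sumn p = D * D + sumn q + sumn (drop D p).
  by rewrite {1}pE sumn_cat sumn_map_add szq.
have sizeE : size p = D + size (drop D p).
  by rewrite {1}pE size_cat size_map szq.
rewrite /marked /to_durfee -/q /= !in_rangeE conjugate_sorted drop_sorted //=.
rewrite conjugate_positive ?q0 // (sub_all _ (conjugate_le _ _)) ?szq //.
rewrite /weight /tracked_rank /length_diff /= size_conjugate sumn_conjugate //.
have -> : all (leq 1) (drop D p) by apply/allP => y /mem_drop /(allP p1).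
have -> : all (fun y => y <= D) (drop D p).
  apply/(all_nthP 0) => i _; rewrite nth_drop.
  by apply: leq_trans below; apply: nth_sorted_le; rewrite ?leq_addr.
move: rp; rewrite /rank /= expnS expn1; lia.
Qed.

Lemma of_durfee_facts D a b : 0 < D -> in_range 1 D a -> in_range 1 D b ->
  let p := of_durfee D [:: (a, b)] in
  [/\ is_partition p, sumn p = D ^ 2 + sumn a + sumn b,
      rank p = ((size b)%:Z - (size a)%:Z)%R, durfee p = D &
      to_durfee D p = [:: (a, b)]].
Proof.
move=> D0; rewrite !in_rangeE => /and3P[sa a1 aD] /and3P[sb b1 bD] /=.
have szc : size [seq D + y | y <- conjugate D b] = D by rewrite size_map size_conjugate.
have lp : largest ([seq D + y | y <- conjugate D b] ++ a) = D + size b.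
  have := head_conjugate D0 b1; case: (conjugate D b) szc => [|y c] /=; first lia.
  by move=> _ ->.
split.
- apply/andP; split.
    rewrite sorted_pairwise; last by move=> x y z; rewrite /geq /=; lia.
    rewrite pairwise_cat -!sorted_pairwise ?sa ?andbT;
      try by move=> x y z; rewrite /geq /=; lia.
    apply/andP; split.
      apply/allrelP => _ y /mapP[x _ ->] /(allP aD); rewrite /geq /=; lia.
    rewrite sorted_map; apply: (@sub_sorted _ geq); last exact: conjugate_sorted.
    by move=> x y /=; rewrite /geq /= leq_add2l.
  by rewrite all_cat a1 andbT; apply/allP => _ /mapP[x _ ->]; lia.
- by rewrite sumn_cat sumn_map_add size_conjugate sumn_conjugate // expnS expn1; lia.
- by rewrite /rank lp size_cat szc; lia.
- apply/durfeeP; split=> [i iD|]; rewrite nth_cat szc.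
    by rewrite iD (nth_map 0) ?size_conjugate //; lia.
  rewrite ltnn subnn; case: (a) aD => //= y a' /andP[].
  by [].
rewrite /to_durfee lp drop_size_cat // take_size_cat //.
rewrite -map_comp (eq_map (g := id)) ?map_id; last by move=> y /=; lia.
by rewrite addKn conjugateK.
Qed.

(** A partition with Durfee side [D] has largest part [D] plus the length of beta and [D] plus the
    length of alpha parts; hence the sign in [- m]. *)
Lemma N_durfee K n0 n (m : int) : 0 < K -> 0 < n -> n <= n0 ->
  N m n = \sum_(1 <= D < n.+1)
    marked_count K n0 [:: true] D (n%:Z - (D ^ 2)%:Z)%R (- m)%R.
Proof.
move=> K0 n_gt0 nn0.
rewrite /N (card_count (@parts n) (fun p => is_partition_of n p && (rank p == m))).
rewrite (@count_classes _ _ durfee 1 n.+1); last first.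
  move=> p /andP[/andP[/andP[sp p1] /eqP pn] _].
  have [above below] := (durfeeP (durfee p) p).1 erefl.
  rewrite ltnS; apply/andP; split.
    case: (posnP (durfee p)) => // d0; rewrite d0 in below.
    by case: p pn sp p1 {above d0} below => [|y p] /=; lia.
  rewrite -pn; apply: leq_trans (size_le_sumn p1).
  case: (leqP (durfee p) (size p)) => // lt.
  by have := above _ lt; rewrite nth_default.
apply: eq_big_nat => D /andP[D0 _].
apply: (@count_bij _ _ _ _ _ _ (to_durfee D) (of_durfee D)).
- by rewrite map_inj_uniq ?enum_uniq //; apply: parts_inj.
- exact: universe_uniq.
- move=> p _ /andP[/andP[pn /eqP rp] /eqP pD].
  have mp := to_durfee_marked D0 pn rp pD.
  split=> //; first by apply: marked_universe mp => //; lia.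
  by case/andP: pn => /andP[sp p1] _; apply: of_to_durfee.
case=> [|[a b] [|ab t]] _ //; first last.
  by case/and4P.
rewrite /marked /= => /and3P[/andP[ra rb] /eqP wx /eqP rx].
have [pp sp rp dp tp] := of_durfee_facts D0 ra rb.
rewrite /weight /= addn0 in wx; rewrite /tracked_rank /length_diff /= in rx.
have pn : sumn (of_durfee D [:: (a, b)]) = n by rewrite sp; lia.
split=> //.
  have [|q qE] := bounded_onto (n := n) pp; first by rewrite pn.
  rewrite -[X in X \in _]/(of_durfee D [:: (a, b)]) -qE.
  by apply: map_f; rewrite mem_enum.
by rewrite /is_partition_of pp pn rp dp !eqxx /= andbT; apply/eqP; lia.
Qed.

(** * From arrays to chains *)

Definition partition_pair (ab : seq nat * seq nat) : bool :=
  is_partition ab.1 && is_partition ab.2.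

Definition adjacent (D : nat) (ab ab' : seq nat * seq nat) : bool :=
  (ab'.1 != [::]) &&
  (largest ab'.2 <= largest ab'.1 <= minn (smallest D ab.1) (smallest D ab.2)).

Lemma leq_last M D p : path geq D p -> (M <= last D p) = (M <= D) && all (leq M) p.
Proof.
elim: p D => [|y p IH] D /=; first by rewrite andbT.
rewrite {1}/geq /= => /andP[yD /IH ->].
by case: (leqP M y) => My; rewrite ?andbF // (leq_trans My yD).
Qed.

(** Arrays give an empty row the side as default, chains the current bound. Only an empty row sees
    the default, and then both inequalities hold. *)
Lemma leq_last_default M D D' p : M <= D -> D <= D' ->
  (M <= last D' p) = (M <= last D p).
Proof. by case: p => //= MD DD'; rewrite MD (leq_trans MD DD'). Qed.

Lemma path_largest D p : path geq D p = (largest p <= D) && sorted geq p.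
Proof. by case: p. Qed.

(* A is the unstripped top row: either a itself, when D = D', or D :: a. *)
Lemma top_wf_path D' D A a b t : D <= D' -> smallest D' A = last D a ->
  top_wf D a b t =
  [&& in_range 1 D a, in_range 1 D b, all partition_pair t &
      path (adjacent D') (A, b) t].
Proof.
elim: t D A a b => [|[[|M a'] b'] t IH] D A a b DD' AE; rewrite ?andbT //.
  by rewrite /= /adjacent /= !andbF.
case: (leqP M D) => MD; last first.
  apply/idP/idP => [/and5P[_ MD' _ _ _]|]; first lia.
  case/and4P=> /andP[pa _] _ _ /= /andP[/and3P[_ _ leM] _].
  by move: leM; rewrite leq_min /= AE leq_last // => /andP[/andP[MD' _] _]; lia.
have IHM := IH M (M :: a') a' b' (leq_trans MD DD') erefl.
apply/idP/idP => /=.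
  case/and5P=> M0 _ ra rb; rewrite IHM => /and4P[ra' rb' pt pth].
  rewrite (in_range_low M0 ra) (in_range_low M0 rb) /= pt pth.
  rewrite /partition_pair /= (in_range_partition _ rb') //.
  rewrite (@in_range_partition 1 M) ?in_range_cons //= andbT.
  rewrite /adjacent /=; case/andP: rb' => + _; rewrite path_largest => /andP[-> _].
  case/andP: ra rb => pa all_a /andP[pb all_b].
  by rewrite leq_min AE leq_last // MD all_a (@leq_last_default _ D) // leq_last // MD all_b.
case/and4P=> /andP[pa pos_a] /andP[pb pos_b].
rewrite /= /partition_pair /is_partition /adjacent /=.
case/andP=> /andP[/andP[sa' /andP[M0 pos_a']] /andP[sb' pos_b']] pt.
case/andP=> /andP[/= b'M]; rewrite leq_min AE leq_last //.
rewrite (@leq_last_default _ D) // leq_last // => /andP[/andP[_ all_a] /andP[_ all_b]] pth.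
by rewrite M0 MD IHM pt pth /in_range pa pb all_a all_b pos_a' pos_b' sa' path_largest b'M sb'.
Qed.

Lemma wf_sorted D x : wf D x =
  [&& x != [::], largest (head ([::], [::]) x).1 <= D,
      largest (head ([::], [::]) x).2 <= D,
      all partition_pair x & sorted (adjacent D) x].
Proof.
case: x => //= -[a b] t; rewrite (@top_wf_path D D a) // /in_range !path_largest.
rewrite /partition_pair /is_partition /= -!andbA; do !bool_congr.
Qed.

Lemma weight_rev x : weight (rev x) = weight x.
Proof. by rewrite /weight map_rev sumn_rev. Qed.

(** Superscripts count from the bottom, chains from the top: position [i] of [rev s] has superscript
    [k - i]. *)
Lemma marked_durfee_symbol_wf k n s D : 0 < k ->
  is_marked_durfee_symbol k n (s, D) =
  [&& 0 < D, wf D (rev s), size s == k & weight s + D ^ 2 == n].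
Proof.
move=> k0; rewrite /is_marked_durfee_symbol /side /=.
case: (eqVneq (size s) k) => [sk|]; last by rewrite !andbF.
case D0: (0 < D) => //=.
have -> : \sum_(1 <= j < k.+1) (sumn (alpha (s, D) j) + sumn (beta (s, D) j)) = weight s.
  by rewrite /weight sumnE big_map (big_nth ([::], [::])) big_add1 sk.
rewrite !andbA; congr (_ && _); rewrite wf_sorted.
have nthr i : i < k -> nth ([::], [::]) (rev s) i = nth ([::], [::]) s (k - i).-1.
  by move=> ik; rewrite nth_rev sk // subnS.
have -> : rev s != [::] by rewrite -size_eq0 size_rev sk; lia.
rewrite -nth0 nthr // subn0 all_rev /=.
apply/idP/idP.
  case/andP=> /andP[/andP[/andP[/forallP parP /forallP neP] /forallP adjP] aD] bD.
  rewrite /alpha /beta /= in aD bD; rewrite aD bD /=.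
  apply/andP; split.
    apply/(all_nthP ([::], [::])) => i; rewrite sk => ik.
    exact: (parP (Ordinal (ik : i.+1 < k.+1))).
  apply/(sortedP ([::], [::])) => i; rewrite size_rev sk => ik.
  rewrite !nthr //; last exact: ltnW.
  have jk : k - i < k.+1 by lia.
  have jk' : (k - i).-1 < k.+1 by lia.
  have /= := adjP (Ordinal jk); have /= := neP (Ordinal jk').
  rewrite /adjacent /alpha /beta /= subnS.
  have -> : 1 < k - i by lia.
  have -> : 0 < (k - i).-1 < k by lia.
  rewrite /= => ne le; rewrite le andbT.
  by apply: contra ne => /eqP e; case: (nth _ _ _) e => ? ? /= ->.
case/and4P=> aD bD /(all_nthP ([::], [::])) parP /(sortedP ([::], [::])) adjP.
rewrite /alpha /beta /= aD bD !andbT.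
have adjE j : 1 < j <= k -> adjacent D (nth ([::], [::]) s j.-1) (nth ([::], [::]) s j.-2).
  move=> /andP[j1 jk]; have := adjP (k - j); rewrite size_rev sk.
  rewrite !nthr; try lia.
  have -> : (k - (k - j)).-1 = j.-1 by lia.
  have -> : (k - (k - j).+1).-1 = j.-2 by lia.
  by apply; lia.
rewrite -andbA; apply/and3P; split; apply/forallP => j; apply/implyP => jb.
- have := ltn_ord j => jk; apply: parP; rewrite sk; lia.
- have /adjE/andP[ne _] : 1 < j.+1 <= k by lia.
  by apply: contra ne => /eqP ->.
- have /adjE/andP[_] : 1 < j <= k by rewrite jb -ltnS ltn_ord.
  by [].
Qed.

(** The pair has index [a] from the bottom and [b] from the top. It is the top pair exactly when
    [b = 0], the case in which neither definition subtracts 1. *)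
Lemma rho_tracked_rank k a b s D : size s = (a + b).+1 -> k = (a + b).+1 ->
  rho k a.+1 (s, D) = tracked_rank (tracking a b) (rev s).
Proof.
move=> szs ->.
have low1 t i : i < size t ->
    lower_rank (nseq i false ++ true :: nseq a false) t =
    (length_diff (nth ([::], [::]) t i) - 1)%R.
  elim: t i => [|ab t IH] [|i] //= it; first by rewrite lower_rank_untracked mul1r addr0.
  by rewrite mul0r add0r IH.
have nthE : nth ([::], [::]) s a = nth ([::], [::]) (rev s) b.
  by rewrite nth_rev szs; [congr nth; lia | lia].
rewrite /rho /alpha /beta /= nthE -/(length_diff _).
have szr : size (rev s) = (a + b).+1 by rewrite size_rev.
case: (rev s) szr => // ab t [szt]; rewrite /tracked_rank /tracking.
case: b {nthE szs} szt => [|b] szt /=; first by rewrite addn0 ltnn lower_rank_untracked mul1r addr0.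
by rewrite low1 ?szt ?mul0r ?add0r; [case: ltnP => //; lia | lia].
Qed.

Theorem theorem2p5 (k i : nat) (hk : 0 < k) (hi : 1 <= i <= k + 1)
    (n : nat) (hn : 0 < n) :
  etabar k n =
  #|[set t : bounded_symbol (k + 1) n |
      is_marked_durfee_symbol (k + 1) n (symbol_of t) &
      (rho (k + 1) i (symbol_of t) < 0)%R]|.
Proof.
pose a := i.-1; pose b := k - a.
have abk : a + b = k by rewrite /b /a; lia.
have iE : i = a.+1 by rewrite /a; lia.
pose P tau := is_marked_durfee_symbol (k + 1) n tau && (rho (k + 1) i tau < 0)%R.
rewrite (card_count (@symbol_of (k + 1) n) P) (@count_classes _ _ side 1 n.+1); last first.
  case=> s D /andP[]; rewrite marked_durfee_symbol_wf; last lia.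
  case/and4P=> D0 _ _ /eqP; rewrite /side /= expnS expn1 => sE _.
  by apply/andP; split=> //; nia.
(* Both sides are split by [D], leaving weight [n - D ^ 2] for the pairs; weights are integers
   because this may be negative. *)
transitivity (\sum_(1 <= D < n.+1) \sum_(1 <= m < n.+1) 'C(m + k - 1, k.*2) *
    marked_count k.+1 n [:: true] D (n%:Z - (D ^ 2)%:Z)%R (- m%:Z)%R).
  rewrite exchange_big_nat /= /etabar; apply: eq_big_nat => m _.
  by rewrite (@N_durfee k.+1 n) // big_distrr mul2n.
apply: eq_big_nat => D /andP[D0 _].
have D20 : 0 < D ^ 2 by rewrite expn_gt0 D0.
rewrite -(@count_negative _ _ _ _ a b) //; try lia.
(* For fixed [D], array and chain differ only in the order of the pairs. *)
symmetry; apply: (@count_bij _ _ _ _ _ _ (fun tau : symbol => rev tau.1)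
  (fun x => (rev x, D))).
- by rewrite map_inj_uniq ?enum_uniq //; apply: symbol_of_inj.
- exact: universe_uniq.
- case=> s D' _ /andP[/andP[]]; rewrite marked_durfee_symbol_wf; last lia.
  case/and4P=> _ ok /eqP szs /eqP wE + /eqP /= DE.
  rewrite /side /= in DE; rewrite DE in ok wE *.
  rewrite iE (@rho_tracked_rank _ a b) ?abk; [|lia|lia] => neg.
  rewrite /negative ok weight_rev size_rev size_tracking abk szs neg addn1 eqxx /= andbT.
  split; [|by apply/eqP; lia|by rewrite revK].
  apply: mem_universe (wf_partitions ok) _; first by rewrite size_rev szs; lia.
  by rewrite weight_rev; lia.
move=> x _ /and4P[ok /eqP szx /eqP wx neg].
rewrite size_tracking abk in szx.
have mx : is_marked_durfee_symbol (k + 1) n (rev x, D).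
  rewrite marked_durfee_symbol_wf; last lia.
  by rewrite D0 revK ok size_rev szx weight_rev addn1 eqxx /=; apply/eqP; lia.
split; last by rewrite /= revK.
  have [t <-] := bounded_symbol_onto mx.
  by apply: map_f; rewrite mem_enum.
rewrite /P mx iE (@rho_tracked_rank _ a b) ?size_rev ?abk ?revK; [|lia|lia].
by rewrite neg /side /= eqxx.
Qed.
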